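(* Let $\mathcal M$ be an o-minimal expansion of a real closed field and let $G$ be a group definable in $\mathcal M$. For any definable type $p\in S_G(M)$ there is a $\mu$-reduced definable type $q\in S_G(M)$ with $p_\mu=q_\mu$.
   Context: $\mathcal M$ has universe $M$; ''definable'' means definable in $\mathcal M$ with parameters from $M$. By Pillay's theorem $G$ carries a definable manifold topology making it a topological group. $S_G(M)$ is the set of complete types over $M$ containing $x\in G$. A type $p$ is definable if for every formula $\phi(x,y)$ the set $\{a:\phi(x,a)\in p\}$ is definable with parameters from $M$. $\dim p$ is the minimum of $\dim D$ over definable sets $D$ in $p$. The infinitesimal type $\mu$ is the partial type over $M$ of all formulas over $M$ defining open neighborhoods of the identity in $G$. For $G$-formulas $\varphi,\psi$ over $M$, $\varphi\cdot\psi$ defines $\{ab:\varphi(a),\psi(b)\}$; $\mu\cdot p=\{\varphi\cdot\psi:\mu\vdash\varphi,\ p\vdash\psi\}$. $p\sim_\mu q$ means that $\mu\cdot p$ and $\mu\cdot q$ are logically equivalent partial types, and $p_\mu$ is the $\sim_\mu$-class of $p$. A type $p\in S_G(M)$ is $\mu$-reduced if for every $q\in S_G(M)$ with $q_\mu=p_\mu$ we have $\dim p\le\dim q$. *)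

(* Defs.v *)
From HB Require Import structures.
From mathcomp Require Import all_boot all_order all_algebra.
From mathcomp Require Import boolp classical_sets topology normedtype.
Import Order.TTheory GRing.Theory Num.Theory.
Import numFieldNormedType.Exports.

Set Implicit Arguments.
Unset Strict Implicit.
Unset Printing Implicit Defensive.

Local Open Scope classical_set_scope.
Local Open Scope ring_scope.

(* A first-order structure expanding the ordered field [R]: the symbols of the
   language beyond those of ordered rings, with their interpretations. *)
Record expansion (R : rcfType) := Expansion {
  fsym : Type;
  fsym_arity : fsym -> nat;
  fsym_interp : forall f : fsym, ('I_(fsym_arity f) -> R) -> R;
  rsym : Type;
  rsym_arity : rsym -> nat;
  rsym_interp : forall r : rsym, ('I_(rsym_arity r) -> R) -> Prop
}.

Section Syntax.
Variables (R : rcfType) (M : expansion R).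

(* Terms and formulas over M, i.e. in the language of [M] with a constant for
   every element of [R]; the free variables of [formula n] are indexed by
   ['I_n], and a quantifier binds variable [ord0] of its body, shifting the
   others by one. *)
Inductive term (n : nat) : Type :=
| TVar of 'I_n
| TCst of R
| TAdd of term n & term n
| TOpp of term n
| TMul of term n & term n
| TFun (f : fsym M) of ('I_(fsym_arity f) -> term n).

Inductive formula (n : nat) : Type :=
| FEq of term n & term n
| FLt of term n & term n
| FRel (r : rsym M) of ('I_(rsym_arity r) -> term n)
| FNot of formula n
| FAnd of formula n & formula n
| FEx of formula n.+1.

Definition scons (T : Type) n (a : T) (e : 'I_n -> T) (i : 'I_n.+1) : T :=
  if unlift ord0 i is Some j then e j else a.

Fixpoint teval n (t : term n) (e : 'I_n -> R) : R :=
  match t with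
  | TVar i => e i
  | TCst a => a
  | TAdd t1 t2 => teval t1 e + teval t2 e
  | TOpp t1 => - teval t1 e
  | TMul t1 t2 => teval t1 e * teval t2 e
  | TFun f ts => fsym_interp (fun i => teval (ts i) e)
  end.

Fixpoint sat n (phi : formula n) : ('I_n -> R) -> Prop :=
  match phi with
  | FEq t1 t2 => fun e => teval t1 e = teval t2 e
  | FLt t1 t2 => fun e => teval t1 e < teval t2 e
  | FRel r ts => fun e => rsym_interp (fun i => teval (ts i) e)
  | FNot psi => fun e => ~ sat psi e
  | FAnd psi1 psi2 => fun e => sat psi1 e /\ sat psi2 e
  | FEx psi => fun e => exists a : R, sat psi (scons a e)
  end.

Fixpoint tsubst n m (s : 'I_n -> term m) (t : term n) : term m :=
  match t with
  | TVar i => s i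
  | TCst a => TCst m a
  | TAdd t1 t2 => TAdd (tsubst s t1) (tsubst s t2)
  | TOpp t1 => TOpp (tsubst s t1)
  | TMul t1 t2 => TMul (tsubst s t1) (tsubst s t2)
  | TFun f ts => TFun (fun i => tsubst s (ts i))
  end.

Definition slift n m (s : 'I_n -> term m) : 'I_n.+1 -> term m.+1 :=
  scons (TVar ord0) (fun i => tsubst (fun j => TVar (lift ord0 j)) (s i)).

Fixpoint fsubst n (phi : formula n) : forall m, ('I_n -> term m) -> formula m :=
  match phi with
  | FEq t1 t2 => fun m s => FEq (tsubst s t1) (tsubst s t2)
  | FLt t1 t2 => fun m s => FLt (tsubst s t1) (tsubst s t2)
  | FRel r ts => fun m s => FRel (fun i => tsubst s (ts i))
  | FNot psi => fun m s => FNot (fsubst psi s)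
  | FAnd psi1 psi2 => fun m s => FAnd (fsubst psi1 s) (fsubst psi2 s)
  | FEx psi => fun m s => FEx (fsubst psi (slift s))
  end.

(* [phi(x, a)] for [phi(x, y)] with [x] an n-tuple and [y] an m-tuple. *)
Definition inst n m (phi : formula (n + m)) (a : 'rV[R]_m) : formula n :=
  fsubst phi (fun i => match split i with
                       | inl j => TVar j
                       | inr k => TCst n (a ord0 k)
                       end).

Definition defset n (phi : formula n) : set 'rV[R]_n :=
  [set x | sat phi (fun i => x ord0 i)].

Definition definable n (D : set 'rV[R]_n) : Prop :=
  exists phi : formula n, defset phi = D.

(* [f] matters only on [D]. *)
Definition definable_fun n k (D : set 'rV[R]_n) (f : 'rV[R]_n -> 'rV[R]_k) :=
  definable [set row_mx x (f x) | x in D].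

(* Points are intervals, and [interval R] allows infinite endpoints. *)
Definition o_minimal : Prop :=
  forall D : set 'rV[R]_1, definable D ->
    exists s : seq (interval R),
      forall x : R, D (const_mx x) <-> has (fun I : interval R => x \in I) s.

(* The largest k such that the image of D under some coordinate projection to
   R^k has nonempty interior; the value 0 on the empty set is a convention
   which is never used, since consistent types contain no formula defining the
   empty set. *)
Definition dim_set n (D : set 'rV[R]_n) : nat :=
  \max_(k < n.+1 | `[< exists2 f : 'I_k -> 'I_n, injective f &
                         interior (colsub f @` D) !=set0 >]) k.

(* Partial types over M in n variables are arbitrary sets of formulas. *)
Definition ptype n := set (formula n).

(* Deducibility modulo the complete theory of M with constants for all its
   elements: by that completeness, a formula follows from finitely many others
   exactly when the implication holds in M. *)
Definition entails n (S : ptype n) (phi : formula n) : Prop :=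
  exists (m : nat) (psi : 'I_m -> formula n),
    (forall i, S (psi i)) /\ \bigcap_i defset (psi i) `<=` defset phi.

Definition logically_equivalent n (S T : ptype n) : Prop :=
  (forall phi, T phi -> entails S phi) /\ (forall phi, S phi -> entails T phi).

Definition consistent n (S : ptype n) : Prop :=
  forall (m : nat) (psi : 'I_m -> formula n),
    (forall i, S (psi i)) -> \bigcap_i defset (psi i) !=set0.

Definition complete_type n (p : ptype n) : Prop :=
  consistent p /\ forall phi, p phi \/ p (FNot phi).

Definition definable_type n (p : ptype n) : Prop :=
  forall (m : nat) (phi : formula (n + m)),
    definable [set a : 'rV[R]_m | p (inst phi a)].

(* Dimensions are at most n, so the default value n of the minimum is
   harmless. *)
Definition dim_type n (p : ptype n) : nat :=
  \big[minn/n]_(k < n.+1 | `[< exists2 phi, p phi & dim_set (defset phi) = k >]) k.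

(* A group whose universe is a definable subset of R^n; the operations are
   meaningful only on the universe. *)
Record definable_group n := DefinableGroup {
  gset : set 'rV[R]_n;
  gmul : 'rV[R]_n -> 'rV[R]_n -> 'rV[R]_n;
  gone : 'rV[R]_n;
  ginv : 'rV[R]_n -> 'rV[R]_n;
  gset_definable : definable gset;
  gmul_definable : definable
    [set w | exists x y, [/\ gset x, gset y
                           & w = row_mx (row_mx x y) (gmul x y)]];
  gmul_closed : forall x y, gset x -> gset y -> gset (gmul x y);
  gone_closed : gset gone;
  ginv_closed : forall x, gset x -> gset (ginv x);
  gmulA : forall x y z, gset x -> gset y -> gset z ->
    gmul x (gmul y z) = gmul (gmul x y) z;
  gmul1g : forall x, gset x -> gmul gone x = x;
  gmulg1 : forall x, gset x -> gmul x gone = x;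
  gmulVg : forall x, gset x -> gmul (ginv x) x = gone;
  gmulgV : forall x, gset x -> gmul x (ginv x) = gone
}.

Section Group.
Variables (n : nat) (G : definable_group n).

(* [tau] is the collection of open subsets of a topology on G. *)
Definition topology_on (tau : set (set 'rV[R]_n)) : Prop :=
  [/\ tau `<=` [set U | U `<=` gset G],
      tau (gset G),
      (forall U V, tau U -> tau V -> tau (U `&` V))
    & (forall F : set (set 'rV[R]_n), F `<=` tau -> tau (\bigcup_(U in F) U))].

(* A chart is a definable homeomorphism of a definable open subset of G with an
   open subset of R^k. *)
Definition definable_chart (tau : set (set 'rV[R]_n)) k
    (U : set 'rV[R]_n) (f : 'rV[R]_n -> 'rV[R]_k) : Prop :=
  [/\ tau U, definable U, definable_fun U f,
      {in U &, injective f}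
    & open (f @` U) /\ forall A, A `<=` U -> (tau A <-> open (f @` A))].

Definition definable_manifold (tau : set (set 'rV[R]_n)) : Prop :=
  topology_on tau /\
  exists (k m : nat) (U : 'I_m -> set 'rV[R]_n)
         (f : 'I_m -> 'rV[R]_n -> 'rV[R]_k),
    (forall i, definable_chart tau (U i) (f i)) /\ \bigcup_i U i = gset G.

Definition continuous_group_operations (tau : set (set 'rV[R]_n)) : Prop :=
  (forall W x y, tau W -> gset G x -> gset G y -> W (gmul G x y) ->
     exists U V, [/\ tau U, tau V, U x, V y
                   & forall u v, U u -> V v -> W (gmul G u v)]) /\
  (forall W, tau W -> tau [set x | gset G x /\ W (ginv G x)]).

(* The properties which determine the topology given by Pillay's theorem. *)
Definition Pillay_topology (tau : set (set 'rV[R]_n)) : Prop :=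
  definable_manifold tau /\ continuous_group_operations tau.

Definition S_G : set (ptype n) :=
  [set p | complete_type p /\ exists2 phi, p phi & defset phi = gset G].

Definition G_formula (phi : formula n) : Prop := defset phi `<=` gset G.

Definition infinitesimal_type (tau : set (set 'rV[R]_n)) : ptype n :=
  [set phi | tau (defset phi) /\ defset phi (gone G)].

(* [phi . psi] is any formula which defines the product of the two sets. *)
Definition ptype_mul (S T : ptype n) : ptype n :=
  [set chi | exists phi psi,
     [/\ G_formula phi /\ G_formula psi, entails S phi, entails T psi
       & defset chi = [set gmul G a b | a in defset phi & b in defset psi]]].

Section Mu.
Variable tau : set (set 'rV[R]_n).

Let mu : ptype n := infinitesimal_type tau.

Definition mu_equiv (p q : ptype n) : Prop :=
  logically_equivalent (ptype_mul mu p) (ptype_mul mu q).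

Definition mu_class (p : ptype n) : set (ptype n) :=
  [set q | S_G q /\ mu_equiv p q].

Definition mu_reduced (p : ptype n) : Prop :=
  forall q, S_G q -> mu_class q = mu_class p -> (dim_type p <= dim_type q)%N.

End Mu.
End Group.
End Syntax.

(* Main.v *)
(* Choose [q0 ~_mu p] of least dimension and a definable set [X] in [q0] with
   [dim X = dim q0].  Any definable [q ~_mu p] containing [X] will do.  Let [U_t]
   ([t > 0]) be a uniformly definable basis of neighbourhoods of 1.  Then
   [p] contains [U_t X] for every [t > 0], hence, [p] being definable,
   also for a positive infinitesimal [t]: for [x] realizing the extension of
   [p] there is [y] in [X] with [x] in [U_t y], and [q] is the type of such a
   [y].  No elementary extension or choice function is needed: types are
   ultrafilters of definable sets, and a definable type [P] of [x] is extended
   to a pair [(x, y)], [y] in a fibre [S_x] of a definable [S], by requiring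
   that a formula hold on an initial segment of [S_x].  By o-minimality this is
   a complete type; doing this one coordinate of [y] at a time gives [q]. *)
Require Import Defs.
From mathcomp Require Import all_boot all_order all_algebra.
From mathcomp Require Import boolp classical_sets topology normedtype.
Import Order.TTheory GRing.Theory Num.Theory.
Import numFieldNormedType.Exports.

Set Implicit Arguments.
Unset Strict Implicit.
Unset Printing Implicit Defensive.

Local Open Scope classical_set_scope.
Local Open Scope ring_scope.

(** * Closure of definable sets under first-order operations *)

Section Definability.
Variables (R : rcfType) (M : expansion R).

Lemma teval_tsubst n m (s : 'I_n -> term M m) (t : term M n) e :
  teval (tsubst s t) e = teval t (fun i => teval (s i) e).
Proof.
elim: t => [i|a|t1 IH1 t2 IH2|t1 IH1|t1 IH1 t2 IH2|f ts IH] //=;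
  rewrite ?IH1 ?IH2 //.
by congr fsym_interp; apply/funext => i; apply: IH.
Qed.

Lemma teval_slift n m (s : 'I_n -> term M m) a e :
  (fun i => teval (slift s i) (scons a e)) =
  scons a (fun i => teval (s i) e).
Proof.
apply/funext => i; rewrite /slift /scons.
case: unliftP => [j _|_] //=.
  by rewrite teval_tsubst; congr teval; apply/funext => l /=; rewrite liftK.
by rewrite unlift_none.
Qed.

Lemma sat_fsubst n (phi : formula M n) m (s : 'I_n -> term M m) e :
  sat (fsubst phi s) e <-> sat phi (fun i => teval (s i) e).
Proof.
elim: phi m s e => {n} [n t1 t2|n t1 t2|n r ts|n f IH|n f IHf g IHg|n f IH] m s e /=.
- by rewrite !teval_tsubst.
- by rewrite !teval_tsubst.
- have -> : (fun i => teval (tsubst s (ts i)) e) =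
    (fun i => teval (ts i) (fun i => teval (s i) e)) => //.
  by apply/funext => i; rewrite teval_tsubst.
- by split=> h /IH.
- by split=> -[/IHf ? /IHg ?].
- by split=> -[a]; [move/IH|move=> h; exists a; apply/IH; move: h];
    rewrite teval_slift //; exists a.
Qed.

Lemma definableP n (D : set 'rV[R]_n) :
  definable M D <->
  exists phi : formula M n, forall x, D x <-> sat phi (fun i => x ord0 i).
Proof.
split=> [[phi <-]|[phi h]]; exists phi => //.
by apply/seteqP; split=> x /= /h.
Qed.

(** Pulling a definable set back along such a map is a mere substitution of terms. All
    rearrangements of coordinates below are of this kind. *)
Definition term_map n m (f : 'rV[R]_n -> 'rV[R]_m) :=
  forall j, exists t : term M n, forall x, f x ord0 j = teval t (fun i => x ord0 i).

Lemma definable_preim n m (D : set 'rV[R]_m) (f : 'rV[R]_n -> 'rV[R]_m) :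
  definable M D -> term_map f -> definable M (fun x => D (f x)).
Proof.
move=> /definableP[phi h] /choice[s hs]; apply/definableP.
exists (fsubst phi s) => x; rewrite h sat_fsubst.
suff -> : (fun i => f x ord0 i) = (fun i => teval (s i) (fun i => x ord0 i)) by [].
by apply/funext => i; apply: hs.
Qed.

Lemma term_map_id n : term_map (fun x : 'rV[R]_n => x).
Proof. by move=> j; exists (TVar M j). Qed.

Lemma term_map_cst n m (a : 'rV[R]_m) : term_map (fun _ : 'rV[R]_n => a).
Proof. by move=> j; exists (TCst M n (a ord0 j)). Qed.

Lemma term_map_lsub n m k (f : 'rV[R]_n -> 'rV[R]_(m + k)) :
  term_map f -> term_map (fun x => lsubmx (f x)).
Proof. by move=> h j; have [t ht] := h (lshift k j); exists t => x; rewrite mxE. Qed.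

Lemma term_map_rsub n m k (f : 'rV[R]_n -> 'rV[R]_(m + k)) :
  term_map f -> term_map (fun x => rsubmx (f x)).
Proof. by move=> h j; have [t ht] := h (rshift m j); exists t => x; rewrite mxE. Qed.

Lemma term_map_row n m k (f : 'rV[R]_n -> 'rV[R]_m) (g : 'rV[R]_n -> 'rV[R]_k) :
  term_map f -> term_map g -> term_map (fun x => row_mx (f x) (g x)).
Proof.
move=> hf hg j; case: (split_ordP j) => i ->.
  by have [t ht] := hf i; exists t => x; rewrite row_mxEl.
by have [t ht] := hg i; exists t => x; rewrite row_mxEr.
Qed.

Lemma definable_lt n m k (f : 'rV[R]_n -> 'rV[R]_m) (g : 'rV[R]_n -> 'rV[R]_k) i j :
  term_map f -> term_map g -> definable M (fun x => f x ord0 i < g x ord0 j).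
Proof.
move=> /(_ i)[t ht] /(_ j)[u hu]; apply/definableP; exists (FLt t u) => x /=.
by rewrite ht hu.
Qed.

Lemma definable_and n (D E : set 'rV[R]_n) :
  definable M D -> definable M E -> definable M (fun x => D x /\ E x).
Proof.
move=> /definableP[f hf] /definableP[g hg]; apply/definableP.
by exists (FAnd f g) => x; rewrite /= hf hg.
Qed.

Lemma definable_not n (D : set 'rV[R]_n) :
  definable M D -> definable M (fun x => ~ D x).
Proof.
move=> /definableP[f hf]; apply/definableP.
by exists (FNot f) => x; rewrite /= hf.
Qed.

Lemma definable_imp n (D E : set 'rV[R]_n) :
  definable M D -> definable M E -> definable M (fun x => D x -> E x).
Proof.
move=> hD hE; have := definable_not (definable_and hD (definable_not hE)).
congr definable; apply/seteqP; split=> x /=; last by move=> h [/h].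
by move=> h Dx; apply: contrapT => nE; apply: h.
Qed.

Lemma definable_true n : definable M (fun _ : 'rV[R]_n => True).
Proof. by apply/definableP; exists (FEq (TCst M n 0) (TCst M n 0)). Qed.

Lemma definable_le n m k (f : 'rV[R]_n -> 'rV[R]_m) (g : 'rV[R]_n -> 'rV[R]_k) i j :
  term_map f -> term_map g -> definable M (fun x => f x ord0 i <= g x ord0 j).
Proof.
move=> hf hg; have := definable_not (definable_lt j i hg hf).
by congr definable; apply/seteqP; split=> x /=; rewrite leNgt => /negP.
Qed.

Lemma definable_ex1 n (D : set 'rV[R]_(n + 1)) :
  definable M D -> definable M (fun x => exists y, D (row_mx x y)).
Proof.
move=> /definableP[phi h]; apply/definableP.
(* A quantifier binds variable [ord0], while the coordinate to be bound is the last one of the row;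
   [s] performs this permutation. *)
pose s (i : 'I_(n + 1)) : term M n.+1 :=
  match split i with inl j => TVar M (lift ord0 j) | inr _ => TVar M ord0 end.
exists (FEx (fsubst phi s)) => x /=.
suff E a : sat (fsubst phi s) (scons a (fun i => x ord0 i)) <->
    D (row_mx x (const_mx a)).
  split=> [[y Dy]|[a /E Da]]; last by exists (const_mx a).
  exists (y ord0 ord0); apply/E; suff -> : const_mx (y ord0 ord0) = y by [].
  by apply/rowP => i; rewrite mxE (ord1 i).
rewrite sat_fsubst h.
suff -> : (fun i => teval (s i) (scons a (fun i0 => x ord0 i0))) =
  (fun i => row_mx x (const_mx a) ord0 i) by [].
apply/funext => i; rewrite /s mxE; case: (split i) => j /=.
  by rewrite /scons liftK.
by rewrite /scons unlift_none mxE.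
Qed.

Lemma definable_ex n m (P : 'rV[R]_n -> 'rV[R]_m -> Prop) :
  definable M (fun z => P (lsubmx z) (rsubmx z)) ->
  definable M (fun x => exists y, P x y).
Proof.
elim: m n P => [|m IH] n P hP.
  have := definable_preim hP (term_map_row (@term_map_id n) (@term_map_cst n 0 0)).
  congr definable; apply/seteqP; split=> x /=; rewrite row_mxKl row_mxKr.
    by exists 0.
  by case=> y; rewrite [y]thinmx0.
rewrite -[m.+1]/(1 + m)%N in P hP *.
(* The first coordinate of [y] joins the free variables, so that the induction hypothesis, stated
   for all [n] and [P], handles the other [m]. *)
pose Q (w : 'rV[R]_(n + 1)) (y : 'rV[R]_m) := P (lsubmx w) (row_mx (rsubmx w) y).
have hQ : definable M (fun z => Q (lsubmx z) (rsubmx z)).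
  have tm : term_map (fun z : 'rV[R]_(n + 1 + m) => row_mx (lsubmx (lsubmx z))
     (row_mx (rsubmx (lsubmx z)) (rsubmx z))).
    by do ![apply: term_map_row|apply: term_map_lsub|apply: term_map_rsub|
            apply: term_map_id].
  have := definable_preim hP tm.
  by congr definable; apply/funext => z /=; rewrite row_mxKl row_mxKr.
have := definable_ex1 (IH _ _ hQ); congr definable.
apply/seteqP; split=> x /=.
  by case=> a [y]; rewrite /Q row_mxKl row_mxKr => h; exists (row_mx a y).
case=> y h; exists (lsubmx y), (rsubmx y).
by rewrite /Q row_mxKl row_mxKr hsubmxK.
Qed.

Lemma definable_all n m (P : 'rV[R]_n -> 'rV[R]_m -> Prop) :
  definable M (fun z => P (lsubmx z) (rsubmx z)) ->
  definable M (fun x => forall y, P x y).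
Proof.
move=> hP; have := definable_not (definable_ex (P := fun x y => ~ P x y)
  (definable_not hP)).
congr definable; apply/seteqP; split=> x /= h.
  by move=> y; apply: contrapT => nP; apply: h; exists y.
by case=> y; apply.
Qed.

Lemma definable_forall_ord n k (D : 'I_k -> set 'rV[R]_n) :
  (forall i, definable M (D i)) -> definable M (fun x => forall i, D i x).
Proof.
move=> hD; suff H (s : seq 'I_k) : definable M (fun x => forall i, i \in s -> D i x).
  have := H (enum 'I_k); congr definable.
  by apply/seteqP; split=> x /= h i => [|_]; apply: h; rewrite ?mem_enum.
elim: s => [|j s IH].
  by have := definable_true n; congr definable; apply/seteqP; split.
have := definable_and (hD j) IH; congr definable; apply/seteqP; split=> x /=.
  by move=> [Dj Ds] i; rewrite inE => /orP[/eqP ->|/Ds].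
by move=> h; split=> [|i si]; apply: h; rewrite inE ?eqxx ?si ?orbT.
Qed.

Lemma defset_inst n m (phi : formula M (n + m)) (a : 'rV[R]_m) :
  defset (inst phi a) = fun x => defset phi (row_mx x a).
Proof.
apply/seteqP; split=> x; rewrite /defset /= sat_fsubst;
  suff -> : (fun i => teval (match split i with
     | inl j => TVar M j | inr k => TCst M n (a ord0 k) end) (fun i0 => x ord0 i0)) =
     (fun i => row_mx x a ord0 i) by [].
all: by apply/funext => i; rewrite mxE; case: (split i).
Qed.

End Definability.

Ltac term_map_tac :=
  repeat first [exact: term_map_id | exact: term_map_cst | apply: term_map_row
               | apply: term_map_lsub | apply: term_map_rsub].

(** * Definable types as ultrafilters of definable sets *)

Section Ultrafilters.
Variables (R : rcfType) (M : expansion R).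

(** A complete definable type, seen through the sets its formulas define. The axioms constrain [P]
    on definable sets only; [du_definable] is definability of the type. *)
Record definable_ultrafilter n (P : set (set 'rV[R]_n)) : Prop := {
  du_sub : forall D E, definable M D -> definable M E ->
    (forall x, D x -> E x) -> P D -> P E;
  du_and : forall D E, definable M D -> definable M E ->
    P D -> P E -> P (fun x => D x /\ E x);
  du_false : ~ P (fun _ => False);
  du_or : forall D, definable M D -> P D \/ P (fun x => ~ D x);
  du_definable : forall m (D : set 'rV[R]_(n + m)), definable M D ->
    definable M (fun a => P (fun x => D (row_mx x a))) }.

Lemma definable_false n : definable M (fun _ : 'rV[R]_n => False).
Proof.
have := definable_not (definable_true M n).
by congr definable; apply/seteqP; split=> x //=; apply.
Qed.

Lemma definable_fiber n m (D : set 'rV[R]_(n + m)) a :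
  definable M D -> definable M (fun x => D (row_mx x a)).
Proof. by move=> hD; apply: (definable_preim hD); term_map_tac. Qed.

Lemma definable_fiberr n m (D : set 'rV[R]_(n + m)) x :
  definable M D -> definable M (fun a => D (row_mx x a)).
Proof. by move=> hD; apply: (definable_preim hD); term_map_tac. Qed.

Lemma du_notN n (P : set (set 'rV[R]_n)) D :
  definable_ultrafilter P -> definable M D -> ~ P D -> P (fun x => ~ D x).
Proof. by move=> uP hD nP; case: (du_or uP hD). Qed.

Lemma du_consistent n (P : set (set 'rV[R]_n)) D :
  definable_ultrafilter P -> definable M D -> P D -> ~ P (fun x => ~ D x).
Proof.
move=> uP hD PD PN; apply: (du_false uP).
have hN := definable_not hD.
apply: (du_sub uP (definable_and hD hN) (definable_false n) _ (du_and uP hD hN PD PN)).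
by move=> x [].
Qed.

Lemma du_true n (P : set (set 'rV[R]_n)) D :
  definable_ultrafilter P -> definable M D -> (forall x, D x) -> P D.
Proof.
move=> uP hD allD; apply: contrapT => /(du_notN uP hD) PN; apply: (du_false uP).
by apply: (du_sub uP (definable_not hD) (definable_false n) _ PN) => x; apply.
Qed.

(** If [x] realizes [P], this is the type of [f x]. *)
Lemma du_pushforward n m (f : 'rV[R]_n -> 'rV[R]_m) P :
  term_map M f -> definable_ultrafilter P ->
  definable_ultrafilter (fun D => P (fun x => D (f x))).
Proof.
move=> tf uP; split=> /=.
- move=> D E hD hE DE; apply: (du_sub uP); try exact: definable_preim.
  by move=> x; apply: DE.
- by move=> D E hD hE; apply: (du_and uP); apply: definable_preim.
- exact: du_false uP.
- by move=> D hD; apply: (du_or uP (definable_preim hD tf)).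
move=> k D hD.
pose D' (z : 'rV[R]_(n + k)) := D (row_mx (f (lsubmx z)) (rsubmx z)).
have hD' : definable M D'.
  apply: (definable_preim hD); apply: term_map_row; last by term_map_tac.
  move=> j; have [t ht] := tf j.
  have /choice[s hs] := term_map_lsub (@term_map_id _ M (n + k)).
  exists (tsubst s t) => x; rewrite ht teval_tsubst.
  by congr teval; apply/funext => i; apply: hs.
have := du_definable uP hD'; congr definable; apply/funext => a.
by congr P; apply/funext => x; rewrite /D' row_mxKl row_mxKr.
Qed.

(** The type of [(x, y)] with [y] realizing [Q] and [x] realizing the canonical extension of [P] to
    the parameters [M, y]. Definability of [P] makes the inner condition a definable set of [y], to
    which [Q] applies. *)
Lemma du_tensor n m (P : set (set 'rV[R]_n)) (Q : set (set 'rV[R]_m)) :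
  definable_ultrafilter P -> definable_ultrafilter Q ->
  definable_ultrafilter (fun D : set 'rV[R]_(n + m) =>
    Q (fun y => P (fun x => D (row_mx x y)))).
Proof.
move=> uP uQ.
have dP (D : set 'rV[R]_(n + m)) : definable M D ->
    definable M (fun y => P (fun x => D (row_mx x y))) by move=> hD; exact: (du_definable uP hD).
split=> /=.
- move=> D E hD hE DE; apply: (du_sub uQ (dP _ hD) (dP _ hE)) => y.
  by apply: (du_sub uP); [exact: definable_fiber| exact: definable_fiber|move=> x; apply: DE].
- move=> D E hD hE PD PE.
  apply: (du_sub uQ _ (dP _ (definable_and hD hE)) _
    (du_and uQ (dP _ hD) (dP _ hE) PD PE)).
    by apply: definable_and; apply: dP.
  by move=> y [Dy Ey]; apply: (du_and uP) => //; apply: definable_fiber.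
- move=> h; apply: (du_false uQ).
  apply: (du_sub uQ (dP _ (definable_false _)) (definable_false _) _ h) => y.
  exact: du_false uP.
- move=> D hD; case: (du_or uQ (dP _ hD)) => h; [by left|right].
  apply: (du_sub uQ (definable_not (dP _ hD)) (dP _ (definable_not hD)) _ h) => y.
  by apply: (du_notN uP); apply: definable_fiber.
move=> k D hD.
pose D1 (z : 'rV[R]_(n + (m + k))) :=
  D (row_mx (row_mx (lsubmx z) (lsubmx (rsubmx z))) (rsubmx (rsubmx z))).
have hD1 : definable M D1 by apply: (definable_preim hD); term_map_tac.
have := du_definable uQ (du_definable uP hD1); congr definable.
apply/funext => a; congr Q; apply/funext => y; congr P; apply/funext => x.
by rewrite /D1 !(row_mxKl, row_mxKr).
Qed.

End Ultrafilters.

(** * Left ends of definable subsets of the line *)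

Section OMinimal.
Variables (R : rcfType) (M : expansion R).
Hypothesis omin : o_minimal M.

(** Pigeonhole: if [I] misses [B] below some [b0] in [B], then below [b0] the remaining intervals
    have to meet [B], and induction applies to them. *)
Lemma coinitial_interval (s : seq (interval R)) (B : set R) :
  (exists b, B b) ->
  (forall b, B b -> exists x, [/\ x <= b, B x & has (fun I : interval R => x \in I) s]) ->
  exists2 I : interval R, I \in s &
    forall b, B b -> exists x, [/\ x <= b, B x & x \in I].
Proof.
move=> Bne; elim: s => [|I s IH] hs; first by case: Bne => b /hs[x []].
have [|hI] := pselect (forall b, B b -> exists x, [/\ x <= b, B x & x \in I]).
  by exists I => //; rewrite inE eqxx.
have [|J Js hJ] := IH; last by exists J => //; rewrite inE Js orbT.
move=> b Bb; move/existsNP: hI => [b0 /not_implyP[Bb0 hb0]].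
have [b1 [Bb1 le1 le2]] : exists b1, [/\ B b1, b1 <= b & b1 <= b0].
  by case/orP: (le_total b b0) => h; [exists b|exists b0].
have [x [xb1 Bx /= /orP[xI|xs]]] := hs _ Bb1; last first.
  by exists x; split=> //; apply: le_trans xb1 _.
by case: hb0; exists x; split=> //; apply: le_trans xb1 _.
Qed.

(** [A] holds on the germ of [S] at its left end. The formulation covers at once a least element, an
    infimum outside [S] and a set unbounded below; it fails for empty [S]. *)
Definition initially (S A : set 'rV[R]_1) : Prop :=
  exists y, S y /\ forall y', S y' -> y' ord0 ord0 <= y ord0 ord0 -> A y'.

Lemma const_mx1 (y : 'rV[R]_1) : const_mx (y ord0 ord0) = y.
Proof. by apply/rowP => i; rewrite mxE (ord1 i). Qed.

(* Otherwise both [S `&` A] and [S `\` A] are coinitial in [S]; one of the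
   finitely many intervals making up [S `&` A] is then coinitial too, and by
   convexity it contains points of [S `\` A]. *)
Lemma initially_or (S A : set 'rV[R]_1) : definable M S -> definable M A ->
  (exists y, S y) -> initially S A \/ initially S (fun y => ~ A y).
Proof.
move=> hS hA [y0 Sy0]; apply: contrapT => /not_orP[nA nN].
have hN y : S y -> exists y', [/\ S y', y' ord0 ord0 <= y ord0 ord0 & ~ A y'].
  move=> Sy; apply: contrapT => h; apply: nA; exists y; split=> // y' Sy' le.
  by apply: contrapT => nAy'; apply: h; exists y'.
have hP y : S y -> exists y', [/\ S y', y' ord0 ord0 <= y ord0 ord0 & A y'].
  move=> Sy; apply: contrapT => h; apply: nN; exists y; split=> // y' Sy' le.
  by move=> Ay'; apply: h; exists y'.
have [s hs] := omin (definable_and hS hA).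
pose B x := S (const_mx x) /\ A (const_mx x).
have B1 y : S y -> A y -> B (y ord0 ord0) by rewrite /B const_mx1.
have [b0 Bb0] : exists b, B b.
  by have [y [Sy _ Ay]] := hP _ Sy0; exists (y ord0 ord0); apply: B1.
have [|b Bb|I Is hI] := @coinitial_interval s B; first by exists b0.
  by exists b; split=> //; apply/hs.
have [x [_ [Sx _] xI]] := hI _ Bb0.
have [y [Sy yx nAy]] := hN _ Sx; rewrite mxE in yx.
have [z [Sz zy Az]] := hP _ Sy.
have [w [wz _ wI]] := hI _ (B1 _ Sz Az).
have yI : y ord0 ord0 \in I.
  by apply: (interval_is_interval wI xI); rewrite yx (le_trans wz zy).
have /hs[_] : has (fun I : interval R => y ord0 ord0 \in I) s by apply/hasP; exists I.
by rewrite const_mx1.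
Qed.

Lemma initially_sub (S A B : set 'rV[R]_1) :
  (forall y, S y -> A y -> B y) -> initially S A -> initially S B.
Proof. by move=> AB [y [Sy h]]; exists y; split=> // y' Sy' /h; auto. Qed.

Lemma initially_and (S A B : set 'rV[R]_1) :
  initially S A -> initially S B -> initially S (fun y => A y /\ B y).
Proof.
move=> [y [Sy hy]] [z [Sz hz]].
case/orP: (le_total (y ord0 ord0) (z ord0 ord0)) => le.
  by exists y; split=> // y' Sy' le'; split; [apply: hy|apply/hz/(le_trans le')].
by exists z; split=> // y' Sy' le'; split; [apply/hy/(le_trans le')|apply: hz].
Qed.

Lemma definable_initially n (S A : set 'rV[R]_(n + 1)) :
  definable M S -> definable M A ->
  definable M (fun x => initially (fun y => S (row_mx x y)) (fun y => A (row_mx x y))).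
Proof.
move=> hS hA; apply: definable_ex; apply: definable_and.
  by apply: (definable_preim hS); term_map_tac.
apply: (definable_all (P := fun (z : 'rV[R]_(n + 1)) y' => S (row_mx (lsubmx z) y') ->
   y' ord0 ord0 <= rsubmx z ord0 ord0 -> A (row_mx (lsubmx z) y'))).
apply: definable_imp; first by apply: (definable_preim hS); term_map_tac.
apply: definable_imp; first by apply: definable_le; term_map_tac.
by apply: (definable_preim hA); term_map_tac.
Qed.

(** * Extending a type by one coordinate at the left end of a fibre *)

Section Extension.
Variables (n : nat) (P : set (set 'rV[R]_n)) (S : set 'rV[R]_(n + 1)).
Hypotheses (uP : definable_ultrafilter M P) (hS : definable M S).
Hypothesis PS : P (fun x => exists y, S (row_mx x y)).

Definition leftmost_extension : set (set 'rV[R]_(n + 1)) := fun D =>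
  P (fun x => initially (fun y => S (row_mx x y)) (fun y => D (row_mx x y))).

(** Completeness comes from [initially_or] in each nonempty fibre over a point of [M], and by [PS]
    the set of points with nonempty fibre is in [P]. Definability holds since [initially] is a
    first-order condition on the base point. *)
Lemma leftmost_extension_ultrafilter :
  definable_ultrafilter M leftmost_extension.
Proof.
have dI D : definable M D -> definable M (fun x =>
    initially (fun y => S (row_mx x y)) (fun y => D (row_mx x y))).
  exact: definable_initially.
rewrite /leftmost_extension; split=> /=.
- move=> D E hD hE DE; apply: (du_sub uP (dI _ hD) (dI _ hE)) => x.
  by apply: initially_sub => y _; apply: DE.
- move=> D E hD hE PD PE.
  apply: (du_sub uP _ (dI _ (definable_and hD hE)) _
    (du_and uP (dI _ hD) (dI _ hE) PD PE)).
    by apply: definable_and; apply: dI.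
  by move=> x [Dx Ex]; apply: initially_and.
- move=> h; apply: (du_false uP).
  apply: (du_sub uP (dI _ (definable_false _ _)) (definable_false _ _) _ h) => x.
  by case=> y [Sy hy]; apply: (hy _ Sy).
- move=> D hD; apply: contrapT => /not_orP[nD nN].
  have hN := definable_not hD.
  have h := du_and uP (definable_not (dI _ hD)) (definable_not (dI _ hN))
    (du_notN uP (dI _ hD) nD) (du_notN uP (dI _ hN) nN).
  apply: (du_consistent uP _ PS); first exact: definable_ex1.
  apply: (du_sub uP _ _ _ h).
  + by apply: definable_and; apply: definable_not; [exact: dI hD|exact: dI hN].
  + by apply: definable_not; apply: definable_ex1.
  move=> x [nDx nNx] hx.
  by case: (initially_or (definable_fiberr x hS) (definable_fiberr x hD) hx).
move=> k D hD.
(* In [D] the parameters [a] follow the new coordinate [y]; [D1] and [S1] put [y] last, so that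
   [(x, a)] becomes the base. *)
pose D1 (z : 'rV[R]_((n + k) + 1)) :=
  D (row_mx (row_mx (lsubmx (lsubmx z)) (rsubmx z)) (rsubmx (lsubmx z))).
pose S1 (z : 'rV[R]_((n + k) + 1)) := S (row_mx (lsubmx (lsubmx z)) (rsubmx z)).
have hD1 : definable M D1 by apply: (definable_preim hD); term_map_tac.
have hS1 : definable M S1 by apply: (definable_preim hS); term_map_tac.
have := du_definable uP (definable_initially hS1 hD1); congr definable.
apply/funext => a; congr P; apply/funext => x; congr initially;
  by apply/funext => y; rewrite /S1 /D1 !(row_mxKl, row_mxKr).
Qed.

Lemma leftmost_extension_base D :
  definable M D -> P D -> leftmost_extension (fun z => D (lsubmx z)).
Proof.
move=> hD PD; apply: (du_sub uP _ _ _ (du_and uP hD (definable_ex1 hS) PD PS)).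
- by apply: definable_and => //; apply: definable_ex1.
- have hD1 : definable M (fun z : 'rV[R]_(n + 1) => D (lsubmx z)).
    by apply: (definable_preim hD); term_map_tac.
  exact: (definable_initially hS hD1).
by move=> x [Dx [y Sy]]; exists y; split=> // y' _ _; rewrite row_mxKl.
Qed.

Lemma leftmost_extension_in : leftmost_extension S.
Proof.
apply: (du_sub uP _ _ _ PS); first exact: definable_ex1.
  exact: (definable_initially hS hS).
by move=> x [y Sy]; exists y.
Qed.

End Extension.

Lemma du_extend n m (P : set (set 'rV[R]_n)) (S : set 'rV[R]_(n + m)) :
  definable_ultrafilter M P -> definable M S ->
  P (fun x => exists y, S (row_mx x y)) ->
  exists Q : set (set 'rV[R]_(n + m)), [/\ definable_ultrafilter M Q, Q S &
    forall D, definable M D -> P D -> Q (fun z => D (lsubmx z))].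
Proof.
elim: m n P S => [|m IH] n P S uP hS PS.
  have tf : term_map M (fun x : 'rV[R]_n => row_mx x (0 : 'rV[R]_0)) by term_map_tac.
  exists (fun D => P (fun x => D (row_mx x 0))); split.
  - exact: du_pushforward.
  - move: PS; congr P; apply/funext => x; apply/propext; split; last by exists 0.
    by case=> y; rewrite [y]thinmx0.
  - by move=> D hD; congr P; apply/funext => x; rewrite row_mxKl.
rewrite -[m.+1]/(1 + m)%N in S hS PS *.
pose assoc (z : 'rV[R]_(n + 1 + m)) : 'rV[R]_(n + (1 + m)) :=
  row_mx (lsubmx (lsubmx z)) (row_mx (rsubmx (lsubmx z)) (rsubmx z)).
have tf : term_map M assoc by term_map_tac.
pose S2 z := S (assoc z).
have hS2 : definable M S2 by apply: (definable_preim hS).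
(* [S1] is the projection of [S] that keeps [x] and the first coordinate of [y]. The leftmost
   extension along it contains [S1], which is the hypothesis for adding the remaining [m]
   coordinates. *)
pose S1 (w : 'rV[R]_(n + 1)) := exists y, S2 (row_mx w y).
have hS1 : definable M S1.
  by apply: definable_ex; apply: (definable_preim hS2); term_map_tac.
have PS1 : P (fun x => exists y, S1 (row_mx x y)).
  move: PS; congr P; apply/funext => x; apply/propext; split=> [[y Sy]|[a [y Sy]]].
    exists (lsubmx y), (rsubmx y).
    by rewrite /S2 /assoc !(row_mxKl, row_mxKr) hsubmxK.
  by exists (row_mx a y); move: Sy; rewrite /S2 /assoc !(row_mxKl, row_mxKr).
have uP1 := leftmost_extension_ultrafilter uP hS1 PS1.
have [Q [uQ QS hQ]] := IH _ _ S2 uP1 hS2 (leftmost_extension_in uP hS1 PS1).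
exists (fun D => Q (fun z => D (assoc z))); split=> //.
  exact: du_pushforward.
move=> D hD PD.
have hD1 : definable M (fun w : 'rV[R]_(n + 1) => D (lsubmx w)).
  by apply: (definable_preim hD); term_map_tac.
have := hQ _ hD1 (leftmost_extension_base uP hS1 PS1 hD PD).
by congr Q; apply/funext => z; rewrite /assoc row_mxKl.
Qed.

(** The type of a positive infinitesimal: the left end of the positive half-line. *)
Definition germ_at_0 : set (set 'rV[R]_1) := initially (fun t => 0 < t ord0 ord0).

Lemma germ_at_0_ultrafilter : definable_ultrafilter M germ_at_0.
Proof.
have pos : exists t : 'rV[R]_1, 0 < t ord0 ord0 by exists (const_mx 1); rewrite mxE.
have defpos k (f : 'rV[R]_k -> 'rV[R]_1) : term_map M f ->
    definable M (fun z => 0 < f z ord0 ord0).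
  move=> tf; have := definable_lt ord0 ord0 (@term_map_cst _ M k _ (0 : 'rV[R]_1)) tf.
  by congr definable; apply/funext => z; rewrite mxE.
have hpos := defpos _ _ (@term_map_id _ M 1).
split; rewrite /germ_at_0.
- by move=> D E _ _ DE; apply: initially_sub => t _; apply: DE.
- by move=> D E _ _; apply: initially_and.
- by case=> t [t0 ht]; apply: (ht _ t0).
- by move=> D hD; apply: initially_or.
move=> k D hD; apply: definable_ex; apply: definable_and.
  by apply: defpos; term_map_tac.
apply: (definable_all (P := fun (z : 'rV[R]_(k + 1)) (t : 'rV[R]_1) =>
  0 < t ord0 ord0 -> t ord0 ord0 <= rsubmx z ord0 ord0 -> D (row_mx t (lsubmx z)))).
apply: definable_imp; first by apply: defpos; term_map_tac.
apply: definable_imp; first by apply: definable_le; term_map_tac.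
by apply: (definable_preim hD); term_map_tac.
Qed.

End OMinimal.

(** * Complete types versus ultrafilters; dimension of types *)

Section Types.
Variables (R : rcfType) (M : expansion R) (n : nat).
Implicit Types p : ptype M n.

Lemma complete_type_entails p phi : complete_type p -> entails p phi -> p phi.
Proof.
move=> [cp op] [m [psi [ppsi sub]]]; case: (op phi) => // pN; exfalso.
(* Together with [psi], the formula [FNot phi] would form a finite inconsistent part of [p]. *)
have [|x hx] := cp m.+1 (scons (FNot phi) psi).
  by move=> i; rewrite /scons; case: unlift.
have /= := hx ord0 I; rewrite /scons unlift_none; apply.
apply: sub => i _; have := hx (lift ord0 i) I.
by rewrite /scons liftK.
Qed.

(** Passing from formulas to sets loses nothing for a complete type, as such a type is closed under
    equivalence of formulas. *)
Definition type_sets p : set (set 'rV[R]_n) :=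
  fun D => exists phi, p phi /\ defset phi = D.

Lemma type_sets_defset p phi :
  complete_type p -> type_sets p (defset phi) <-> p phi.
Proof.
move=> cp; split=> [[psi [ppsi E]]|]; last by exists phi.
apply: complete_type_entails => //; exists 1%N, (fun _ => psi); split=> // x hx.
by rewrite -E; apply: (hx ord0).
Qed.

Lemma type_sets_entails p phi : complete_type p ->
  entails p phi -> type_sets p (defset phi).
Proof. by move=> cp /(complete_type_entails cp) h; exists phi. Qed.

Lemma type_sets_ultrafilter p :
  complete_type p -> definable_type p -> definable_ultrafilter M (type_sets p).
Proof.
move=> cp dp; split.
- move=> _ _ [f <-] [g <-] fg /type_sets_defset pf.
  apply/type_sets_defset => //; apply: complete_type_entails => //.
  by exists 1%N, (fun _ => f); split=> [_|x hx]; [apply: pf|apply/fg/(hx ord0)].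
- move=> _ _ [f <-] [g <-] /type_sets_defset pf /type_sets_defset pg.
  apply/(type_sets_defset (FAnd f g)) => //; apply: complete_type_entails => //.
  exists 2%N, (fun i => if i == ord0 then f else g); split.
    by move=> i; case: eqP => _; [apply: pf|apply: pg].
  by move=> x hx; split; [have := hx ord0 I|have := hx ord_max I].
- case=> phi [pphi E]; have [|x hx] := cp.1 1%N (fun _ => phi) => //.
  by have := hx ord0 I; rewrite E.
- move=> _ [f <-]; case: (cp.2 f) => h; [left|right]; first by exists f.
  by exists (FNot f).
move=> m _ [phi <-]; have := dp m phi; congr definable.
apply/seteqP; split=> a /=.
  by move=> h; exists (inst phi a); split=> //; apply: defset_inst.
move=> h; apply/(type_sets_defset _ cp).
by rewrite defset_inst.
Qed.

(** Closure under binary intersections is carried to finite ones along an enumeration of the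
    indices, and [du_false] then forbids an empty intersection. *)
Lemma ultrafilter_complete_type P : definable_ultrafilter M P ->
  complete_type (fun phi : formula M n => P (defset phi)).
Proof.
move=> uP; split=> [m psi hpsi|phi]; last by apply: (du_or uP); exists phi.
have dI : definable M (fun x => forall i, defset (psi i) x).
  by apply: definable_forall_ord => i; exists (psi i).
suff PI : P (fun x => forall i, defset (psi i) x).
  apply: contrapT => nI; apply: (du_false uP).
  apply: (du_sub uP dI (definable_false _ _) _ PI) => x hx.
  by apply: nI; exists x => i _; apply: hx.
have ds (s : seq 'I_m) : definable M (fun x => forall i, i \in s -> defset (psi i) x).
  apply: definable_forall_ord => i; case: (i \in s).
    by have : definable M (defset (psi i)) by [exists (psi i)];
       congr definable; apply/seteqP; split=> x //=; apply.
  by have := definable_true M n; congr definable; apply/seteqP; split.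
suff H (s : seq 'I_m) : P (fun x => forall i, i \in s -> defset (psi i) x).
  have := H (enum 'I_m); congr P; apply/funext => x; apply/propext.
  by split=> h i => [|_]; apply: h; rewrite ?mem_enum.
elim: s => [|j s IH]; first by apply: (du_true uP).
have dj : definable M (defset (psi j)) by exists (psi j).
apply: (du_sub uP (definable_and dj (ds s)) (ds _) _ (du_and uP dj (ds s) _ IH)) => //.
by move=> x [hj hs] i; rewrite inE => /orP[/eqP ->|/hs].
Qed.

Lemma ultrafilter_definable_type P : definable_ultrafilter M P ->
  definable_type (fun phi : formula M n => P (defset phi)).
Proof.
move=> uP m phi; have : definable M (defset phi) by exists phi.
move=> /(du_definable uP); congr definable.
by apply/funext => a; rewrite /= /mkset defset_inst.
Qed.

Lemma dim_set_max (D : set 'rV[R]_n) : (dim_set D <= n)%N.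
Proof. by apply/bigmax_leqP => i _; rewrite -ltnS. Qed.

Lemma big_minn_le (I : eqType) (r : seq I) (Q : pred I) (F : I -> nat) d i :
  i \in r -> Q i -> (\big[minn/d]_(j <- r | Q j) F j <= F i)%N.
Proof.
elim: r => //= j r IH; rewrite inE big_cons => /orP[/eqP <- ->|ir Qi].
  exact: geq_minl.
by case: ifP => _; [apply: leq_trans (geq_minr _ _) _|]; apply: IH.
Qed.

Lemma big_minn_attained (I : eqType) (r : seq I) (Q : pred I) (F : I -> nat) d :
  \big[minn/d]_(j <- r | Q j) F j = d \/
  exists2 i, Q i & \big[minn/d]_(j <- r | Q j) F j = F i.
Proof.
elim: r => [|j r IH]; first by rewrite big_nil; left.
rewrite big_cons; case: ifP => // Qj; rewrite /minn.
by case: ifP => // _; right; exists j.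
Qed.

Lemma dim_type_le p phi : p phi -> (dim_type p <= dim_set (defset phi))%N.
Proof.
move=> pphi; have lt : (dim_set (defset phi) < n.+1)%N by rewrite ltnS dim_set_max.
rewrite /dim_type.
have := @big_minn_le _ (index_enum 'I_n.+1)
  (fun k => `[< exists2 phi, p phi & dim_set (defset phi) = k >]) (@nat_of_ord _) n (Ordinal lt).
by apply; [exact: mem_index_enum|apply/asboolP; exists phi].
Qed.

Lemma dim_type_attained p psi :
  p psi -> exists2 phi, p phi & dim_set (defset phi) = dim_type p.
Proof.
move=> ppsi; have := dim_type_le ppsi; rewrite /dim_type.
have [->|[k /asboolP[phi pphi E] -> _]] := @big_minn_attained _ (index_enum 'I_n.+1)
  (fun k => `[< exists2 phi, p phi & dim_set (defset phi) = k >]) (@nat_of_ord _) n;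
  last by exists phi.
(* Here the minimum has its default value [n]; no dimension exceeds [n], so [psi] itself attains
   it. *)
by move=> le; exists psi => //; apply/eqP; rewrite eqn_leq le dim_set_max.
Qed.

End Types.

(** * Neighbourhoods in charts and a uniform basis at the identity *)

Lemma finite_min (R : rcfType) k (g : 'I_k -> R) :
  (forall i, 0 < g i) -> exists2 e : R, 0 < e & forall i, e <= g i.
Proof.
(* The initial value 1 keeps the minimum positive when there are no indices. *)
move=> g0; exists (\big[Num.min/1]_i g i) => [|i]; last exact: bigmin_le.
by apply/bigmin_gtP.
Qed.

Lemma open_cube (R : rcfType) k (A : set 'rV[R]_k) (c : 'rV[R]_k) (t : R) :
  open A -> open (fun v => A v /\ forall j, `|c ord0 j - v ord0 j| < t).
Proof.
rewrite !openE => oA v [Av vt]; have /nbhs_ballP[e /= e0 eA] := oA _ Av.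
(* [d] is a positive lower bound for the slacks in the [k] strict inequalities; a point moved by
   less than [d] still satisfies them. *)
have [d d0 dt] : exists2 d : R, 0 < d & forall j, d <= t - `|c ord0 j - v ord0 j|.
  by apply: finite_min => j; rewrite subr_gt0.
apply/nbhs_ballP; exists (Num.min e d) => /=; first by rewrite lt_min e0.
move=> w [_ vw]; split; first apply: eA.
  split=> // i j; apply: le_ball (vw i j); by rewrite ge_min lexx.
move=> j; have := vw ord0 j; rewrite -ball_normE /= lt_min => /andP[_ vwd].
apply: le_lt_trans (ler_distD (v ord0 j) _ _) _.
by rewrite -ltrBrDl; apply: lt_le_trans vwd (dt j).
Qed.

Section Group.
Variables (R : rcfType) (M : expansion R) (n : nat).
Variables (G : definable_group M n) (tau : set (set 'rV[R]_n)).
Hypothesis PT : Pillay_topology G tau.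

Let mu : ptype M n := infinitesimal_type G tau.

(** The basis is pulled back, along one chart around the identity, from the open cubes centred at
    the image of the identity; [t] is half the side of the cube. *)
Lemma uniform_basis : exists W : set 'rV[R]_(n + 1),
  let U t u := W (row_mx u (const_mx t)) in
  [/\ definable M W,
      forall t, 0 < t -> tau (U t) /\ U t (gone G),
      forall A, tau A -> A (gone G) -> exists2 t, 0 < t & U t `<=` A
    & forall s t, s <= t -> U s `<=` U t].
Proof.
case: PT => -[[subG tG tI tU] [k [m [C [f [ch cov]]]]]] _.
have [i Ci] : exists i, C i (gone G).
  by have [i _ Ci] : (\bigcup_i C i) (gone G) by [rewrite cov; apply: gone_closed];
  exists i.
have [tC dC dF inj [oC tauC]] := ch i.
pose c := f i (gone G).
pose F : set 'rV[R]_(n + k) := [set row_mx x (f i x) | x in C i].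
(* Formulas reach the chart through its graph [F], hence the quantifier over [v], which [WE]
   eliminates. *)
pose W (z : 'rV[R]_(n + 1)) := exists v : 'rV[R]_k, F (row_mx (lsubmx z) v) /\
   forall j, `|c ord0 j - v ord0 j| < rsubmx z ord0 ord0.
have WE u t : W (row_mx u (const_mx t)) <->
    C i u /\ forall j, `|c ord0 j - f i u ord0 j| < t.
  rewrite /W row_mxKl row_mxKr; split.
    case=> v [[x Cx /eq_row_mx[<- <-]] h]; split=> // j.
    by have := h j; rewrite mxE.
  by case=> Cu h; exists (f i u); split=> [|j]; [exists u|rewrite mxE].
exists W => U; split.
- apply: definable_ex; apply: definable_and.
    by apply: (definable_preim dF); term_map_tac.
  apply: definable_forall_ord => j; apply/definableP.
  have [t ht] := term_map_rsub (term_map_lsub (@term_map_id _ M (n + 1 + k))) ord0.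
  have [u hu] := term_map_rsub (@term_map_id _ M (n + 1 + k)) j.
  pose d := TAdd (TCst M _ (c ord0 j)) (TOpp u).
  exists (FAnd (FLt (TOpp t) d) (FLt d t)) => z /=.
  by rewrite -ht -hu ltr_norml; split=> /andP.
- move=> t t0; split; last first.
    by apply/WE; split=> // j; rewrite subrr normr0.
  have UC : U t `<=` C i by move=> u /WE[].
  apply/(tauC _ UC); have := @open_cube R k _ c t oC; congr open.
  apply/seteqP; split=> v.
    by case=> -[u Cu <-] h; exists u => //; apply/WE.
  by case=> u /WE[Cu h] <-; split=> //; exists u.
- move=> A tA A1; have tAC := tI _ _ tA tC.
  have AC : A `&` C i `<=` C i by move=> x [].
  have /(tauC _ AC) := tAC; rewrite openE => oA.
  have /oA/nbhs_ballP[e /= e0 eA] : (f i @` (A `&` C i)) c by exists (gone G).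
  exists e => // u /WE[Cu h].
  have /eA[x [Ax Cx] E] : ball c e (f i u).
    split=> // a j; rewrite (ord1 a) -ball_normE /=; exact: h.
  suff -> : u = x by [].
  by apply: inj; rewrite ?inE.
move=> s t st u /WE[Cu h]; apply/WE; split=> // j.
exact: lt_le_trans (h j) st.
Qed.

(** * Products of definable subsets of the group *)

Definition prodset (A B : set 'rV[R]_n) : set 'rV[R]_n :=
  [set gmul G a b | a in A & b in B].

(** [gmul] is arbitrary outside the universe, so it is this restricted graph that is known to be
    definable. *)
Definition mul_graph (a b c : 'rV[R]_n) : Prop :=
  [/\ gset G a, gset G b & c = gmul G a b].

Lemma definable_mul_graph k (f g h : 'rV[R]_k -> 'rV[R]_n) :
  term_map M f -> term_map M g -> term_map M h ->
  definable M (fun z => mul_graph (f z) (g z) (h z)).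
Proof.
move=> tf tg th.
have := definable_preim (gmul_definable G) (term_map_row (term_map_row tf tg) th).
congr definable; apply/seteqP; split=> z /=.
  by case=> x [y [Gx Gy /eq_row_mx[/eq_row_mx[-> ->] ->]]].
by case=> Gx Gy ->; exists (f z), (g z).
Qed.

Lemma prodsetE (A B : set 'rV[R]_n) : A `<=` gset G -> B `<=` gset G ->
  prodset A B = fun c => exists b, B b /\ exists a, A a /\ mul_graph a b c.
Proof.
move=> AG BG; apply/seteqP; split=> c.
  by case=> a Aa [b Bb <-]; exists b; split=> //; exists a; split=> //; split;
     [apply: AG|apply: BG|].
by case=> b [Bb [a [Aa [_ _ ->]]]]; exists a => //; exists b.
Qed.

Lemma definable_prodset (A B : set 'rV[R]_n) :
  definable M A -> definable M B -> A `<=` gset G -> B `<=` gset G ->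
  definable M (prodset A B).
Proof.
move=> dA dB AG BG; rewrite prodsetE //.
apply: definable_ex; apply: definable_and.
  by apply: (definable_preim dB); term_map_tac.
apply: (definable_ex (P := fun (z : 'rV[R]_(n + n)) a =>
  A a /\ mul_graph a (rsubmx z) (lsubmx z))).
apply: definable_and; first by apply: (definable_preim dA); term_map_tac.
by apply: definable_mul_graph; term_map_tac.
Qed.

Lemma prodset_sub (A B : set 'rV[R]_n) : A `<=` gset G -> B `<=` gset G ->
  prodset A B `<=` gset G.
Proof. by move=> AG BG _ [a /AG Ga [b /BG Gb <-]]; apply: gmul_closed. Qed.

Lemma prodsetS (A A' B B' : set 'rV[R]_n) :
  A `<=` A' -> B `<=` B' -> prodset A B `<=` prodset A' B'.
Proof. by move=> AA BB _ [a /AA ? [b /BB ? <-]]; exists a => //; exists b. Qed.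

Lemma prodsetA (A B C : set 'rV[R]_n) :
  A `<=` gset G -> B `<=` gset G -> C `<=` gset G ->
  prodset A (prodset B C) = prodset (prodset A B) C.
Proof.
move=> AG BG CG; apply/seteqP; split=> x.
  case=> a Aa [_ [b Bb [c Cc <-]] <-]; exists (gmul G a b).
    by exists a => //; exists b.
  by exists c => //; rewrite gmulA //; [apply: AG|apply: BG|apply: CG].
case=> _ [a Aa [b Bb <-]] [c Cc <-]; exists a => //; exists (gmul G b c).
  by exists b => //; exists c.
by rewrite gmulA //; [apply: AG|apply: BG|apply: CG].
Qed.

(** * The infinitesimal type and products with it *)

Section Basis.
Variable W : set 'rV[R]_(n + 1).
Let U t u := W (row_mx u (const_mx t)).
Hypotheses (dW : definable M W)
  (U_nbhs : forall t, 0 < t -> tau (U t) /\ U t (gone G))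
  (U_basis : forall A, tau A -> A (gone G) -> exists2 t, 0 < t & U t `<=` A)
  (U_mono : forall s t, s <= t -> U s `<=` U t).

Lemma tau_sub A : tau A -> A `<=` gset G.
Proof. by case: PT => -[[subG _ _ _] _] _ /subG. Qed.

Lemma U_sub t : 0 < t -> U t `<=` gset G.
Proof. by move=> /U_nbhs[/tau_sub]. Qed.

Lemma definable_U t : definable M (U t).
Proof. exact: definable_fiber. Qed.

(** Each neighbourhood in a finite family contains some [U t]. As these sets increase with [t], a
    positive lower bound of the parameters serves for the whole family. Conversely, a formula
    defining [U t] is itself in [mu]. *)
Lemma infinitesimal_entails (phi : formula M n) :
  entails mu phi <-> exists2 t, 0 < t & U t `<=` defset phi.
Proof.
split=> [[m [psi [hpsi sub]]]|[t t0 Ut]].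
  have /choice[g hg] : forall i, exists t, 0 < t /\ U t `<=` defset (psi i).
    by move=> i; have [o o1] := hpsi i; have [t] := U_basis o o1; exists t.
  have [e e0 he] : exists2 e : R, 0 < e & forall i, e <= g i.
    by apply: finite_min => i; case: (hg i).
  exists e => // u Uu; apply: sub => i _; apply: (hg i).2.
  exact: U_mono (he i) _ Uu.
have [psi hpsi] := definable_U t.
exists 1%N, (fun _ => psi); split=> [_|x hx].
  by have := U_nbhs t0; rewrite /mu /infinitesimal_type /= hpsi.
by apply: Ut; have := hx ord0 I; rewrite hpsi.
Qed.

(** Continuity of multiplication at the pair of identities. *)
Lemma U_mul t : 0 < t -> exists2 s, 0 < s & prodset (U s) (U s) `<=` U t.
Proof.
move=> /U_nbhs[tU U1]; have G1 := gone_closed G.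
case: PT => _ [/(_ (U t) _ _ tU G1 G1)].
rewrite gmul1g // => /(_ U1)[A [B [tA tB A1 B1 AB]]] _.
have [a a0 UA] := U_basis tA A1; have [b b0 UB] := U_basis tB B1.
exists (Num.min a b); first by rewrite lt_min a0.
move=> _ [u Uu [v Uv <-]]; apply: AB.
  by apply/UA/(U_mono _ Uu); rewrite ge_min lexx.
by apply/UB/(U_mono _ Uv); rewrite ge_min lexx orbT.
Qed.

Lemma ginv1 : ginv G (gone G) = gone G.
Proof.
have G1 := gone_closed G.
by rewrite -[LHS](gmulg1 (ginv_closed G1)) gmulVg.
Qed.

(** Continuity of inversion at the identity, which is its own inverse. *)
Lemma U_inv t : 0 < t -> exists2 s, 0 < s & forall u, U s u -> U t (ginv G u).
Proof.
move=> /U_nbhs[tU U1]; case: PT => _ [_ /(_ _ tU) tV].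
have [|s s0 Us] := U_basis tV; first by rewrite /= ginv1; split=> //; apply: gone_closed.
by exists s => // u /Us[].
Qed.

(** This turns each half of mu-equivalence into a statement about sets in types. Left to right: the
    first factor of a product contains the identity, so every formula of [ptype_mul G mu p] contains
    a set of [p], and whatever that product entails is in [p]. Right to left: for a product of [phi]
    and [psi] with [U t] inside [phi], choose [s] such that the product of [U s] with itself lies in
    [U t]; then [U s] times [psi] is in [p], and multiplying by [U s] once more gives a formula of
    [ptype_mul G mu p] inside the given product. *)
Lemma ptype_mul_entails (p q : ptype M n) : complete_type p -> complete_type q ->
  (forall phi, ptype_mul G mu q phi -> entails (ptype_mul G mu p) phi) <->
  (forall s D, 0 < s -> definable M D -> D `<=` gset G -> type_sets q D ->
     type_sets p (prodset (U s) D)).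
Proof.
move=> cp cq; split=> [H s D s0 dD DG qD|H chi].
  have [phi hphi] := definable_U s.
  have [psi [qpsi hpsi]] := qD.
  have [chi hchi] := definable_prodset (definable_U s) dD (U_sub s0) DG.
  have [|m [al [hal sub]]] := H chi.
    exists phi, psi; rewrite /G_formula hphi hpsi; split=> //.
    - by split=> //; apply: U_sub.
    - by apply/infinitesimal_entails; exists s; rewrite ?hphi.
    - by exists 1%N, (fun _ => psi); split=> // x hx; apply: (hx ord0).
  rewrite -hchi; apply/type_sets_defset => //; apply: complete_type_entails => //.
  have /choice[be hbe] : forall i, exists be, p be /\ defset be `<=` defset (al i).
    move=> i; have [f [g [[Gf Gg] ef eg ->]]] := hal i.
    exists g; split; first exact: complete_type_entails.
    have /infinitesimal_entails[t t0 Uf] := ef.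
    move=> x gx; exists (gone G); first by apply/Uf/(U_nbhs t0).2.
    by exists x => //; rewrite gmul1g //; apply: Gg.
  exists m, be; split=> [i|x hx]; first exact: (hbe i).1.
  by apply: sub => i _; apply/(hbe i).2/hx.
case=> phi [psi [[Gphi Gpsi] /infinitesimal_entails[t t0 Ut] epsi Echi]].
have [s s0 Us] := U_mul t0; have sG := U_sub s0.
have qpsi : type_sets q (defset psi) by apply: type_sets_entails.
have dpsi : definable M (defset psi) by exists psi.
have [f [pf hf]] := H s _ s0 dpsi Gpsi qpsi.
have [g hg] := definable_U s.
have fG : defset f `<=` gset G by rewrite hf; apply: prodset_sub.
have df : definable M (defset f) by exists f.
have [h hh] := definable_prodset (definable_U s) df sG fG.
exists 1%N, (fun _ => h); split=> [_|x /(_ ord0 I)].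
  exists g, f; rewrite /G_formula hg; split=> //.
  - by apply/infinitesimal_entails; exists s; rewrite ?hg.
  - by exists 1%N, (fun _ => f); split=> // x hx; apply: (hx ord0).
rewrite Echi hh hf prodsetA //; apply: prodsetS => //.
exact: subset_trans Us Ut.
Qed.

End Basis.

End Group.

(** * Logical equivalence of partial types as an equivalence relation *)

Section LogicalEquivalence.
Variables (R : rcfType) (M : expansion R) (n : nat).
Implicit Types S T : ptype M n.

Lemma entails_refl S phi : S phi -> entails S phi.
Proof.
by move=> Sphi; exists 1%N, (fun _ => phi); split=> // x hx; apply: (hx ord0).
Qed.

Lemma entails_trans S T phi :
  (forall psi, T psi -> entails S psi) -> entails T phi -> entails S phi.
Proof.
move=> ST [m [psi [Tpsi sub]]].
have /choice[al hal] : forall i, exists al : {k : nat & 'I_k -> formula M n},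
    (forall j, S (projT2 al j)) /\
    \bigcap_j defset (projT2 al j) `<=` defset (psi i).
  by move=> i; have [k [al hal]] := ST _ (Tpsi i); exists (existT _ k al).
(* Each of the [m] premises has its own finite derivation from [S]; the formulas used are indexed
   together by this disjoint union. *)
pose J := {i : 'I_m & 'I_(projT1 (al i))}.
exists #|{: J}|, (fun k => projT2 (al (tag (enum_val k))) (tagged (enum_val k))).
split=> [k|x hx]; first exact: (hal _).1.
apply: sub => i _; apply: (hal i).2 => j _.
by have := hx (enum_rank (Tagged (fun i => 'I_(projT1 (al i))) j)) I; rewrite enum_rankK.
Qed.

Lemma logically_equivalent_trans S T V :
  logically_equivalent S T -> logically_equivalent T V -> logically_equivalent S V.
Proof.
move=> [ST TS] [TV VT]; split=> phi.
  by move=> /TV; apply: entails_trans.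
by move=> /TS; apply: entails_trans.
Qed.

Lemma logically_equivalentC S T : logically_equivalent S T -> logically_equivalent T S.
Proof. by case. Qed.

Lemma logically_equivalent_refl S : logically_equivalent S S.
Proof. by split=> phi; apply: entails_refl. Qed.

End LogicalEquivalence.

(** * Replacing a type by a definable one in the same class *)

Section Replacement.
Variables (R : rcfType) (M : expansion R) (n : nat).
Variables (G : definable_group M n) (tau : set (set 'rV[R]_n)).
Hypotheses (omin : o_minimal M) (PT : Pillay_topology G tau).

Lemma mu_class_eq (p q : ptype M n) :
  mu_equiv G tau p q -> mu_class G tau p = mu_class G tau q.
Proof.
move=> pq; apply/seteqP; split=> r [Sr h]; split=> //.
  exact: logically_equivalent_trans (logically_equivalentC pq) h.
exact: logically_equivalent_trans pq h.
Qed.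

(** [q0] contributes the formula [psi], chosen later to have the least dimension; definability is
    inherited from [p], since [q] is the image of an extension of [p]. *)
Lemma mu_equiv_definable_type (p q0 : ptype M n) (psi : formula M n) :
  S_G G p -> definable_type p -> S_G G q0 -> mu_equiv G tau p q0 -> q0 psi ->
  exists q : ptype M n,
    [/\ S_G G q, definable_type q, mu_equiv G tau p q & q psi].
Proof.
move=> [cp _] dp [cq0 [gam q0gam hgam]] [pq0 _] q0psi.
have [W] := uniform_basis PT.
set U := fun t u => W (row_mx u (const_mx t)) => -[dW U_nbhs U_basis U_mono].
pose X x := defset psi x /\ gset G x.
have XG : X `<=` gset G by move=> x [].
have dX : definable M X by exists (FAnd psi gam); rewrite /X -hgam.
have q0X : type_sets q0 X.
  exists (FAnd psi gam); split; last by rewrite /X -hgam.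
  apply: complete_type_entails => //.
  exists 2%N, (fun i => if i == ord0 then psi else gam); split.
    by move=> i; case: eqP.
  by move=> x hx; split; [have := hx ord0 I|have := hx ord_max I].
have pX t : 0 < t -> type_sets p (prodset G (U t) X).
  move=> t0; have /(ptype_mul_entails PT dW U_nbhs U_basis U_mono cp cq0) := pq0.
  exact.
pose P := type_sets p.
have uP : definable_ultrafilter M P by apply: type_sets_ultrafilter.
have dpush k (D : set 'rV[R]_n) (f : 'rV[R]_k -> 'rV[R]_n) :
  definable M D -> term_map M f -> definable M (fun z => D (f z)).
  exact: definable_preim.
(* A row [z] stands for a triple [(x, t, y)]; [S] will say that [y] is in [X] and [x] is in
   [U_t y]. *)
pose N := (n + 1 + n)%N.
pose px (z : 'rV[R]_N) := lsubmx (lsubmx z).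
pose pt (z : 'rV[R]_N) := rsubmx (lsubmx z).
pose py (z : 'rV[R]_N) := rsubmx z.
have tx : term_map M px by rewrite /px; term_map_tac.
have ty : term_map M py by rewrite /py; term_map_tac.
pose S z := X (py z) /\ exists u, W (row_mx u (pt z)) /\ mul_graph G u (py z) (px z).
have dS : definable M S.
  apply: definable_and; first exact: dpush.
  apply: definable_ex; apply: definable_and.
    by apply: (definable_preim dW); rewrite /pt; term_map_tac.
  by apply: definable_mul_graph; rewrite /px /py; term_map_tac.
(* The base type is that of [(x, t)] with [t] positive infinitesimal over [M] and [x] realizing the
   extension of [p] to [M, t]. By [pX] the condition of having a fibre point is in [p] for every
   positive [t] of [M], so any endpoint, such as 1, gives an initial segment. *)
have [|Q [uQ QS hQ]] := du_extend omin
    (du_tensor uP (germ_at_0_ultrafilter omin)) dS.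
  exists (const_mx 1); split=> [|t t0 _]; first by rewrite mxE.
  have := pX _ t0; rewrite prodsetE //; last exact: (U_sub PT U_nbhs t0).
  congr type_sets; apply/funext => x; apply/propext; rewrite /U const_mx1.
  split=> -[y].
    by move=> [Xy hy]; exists y; rewrite /S /px /py /pt !(row_mxKl, row_mxKr).
  by rewrite /S /px /py /pt !(row_mxKl, row_mxKr); exists y.
have Qx D : definable M D -> P D -> Q (fun z => D (px z)).
  move=> dD PD; apply: (hQ (fun w => D (lsubmx w))).
    by apply: (definable_preim dD); term_map_tac.
  exists (const_mx 1); split=> [|t _ _]; first by rewrite mxE.
  by move: PD; congr P; apply/funext => x; rewrite row_mxKl.
have dle s k (f : 'rV[R]_k -> 'rV[R]_1) : term_map M f ->
    definable M (fun z => f z ord0 ord0 <= s).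
  move=> tf; have := definable_le ord0 ord0 tf (@term_map_cst _ M k _ (const_mx s : 'rV[R]_1)).
  by congr definable; apply/funext => z; rewrite mxE.
have Qt s : 0 < s -> Q (fun z => pt z ord0 ord0 <= s).
  move=> s0; apply: (hQ (fun w => rsubmx w ord0 ord0 <= s)).
    by apply: dle; term_map_tac.
  (* The segment up to [s] witnesses that the infinitesimal [t] lies below [s]. *)
  exists (const_mx s); split=> [|t _]; first by rewrite mxE.
  rewrite mxE => ts; apply: (du_true uP) => [|x]; last by rewrite row_mxKr.
  have := definable_true M n; congr definable; apply/funext => x.
  by apply/propext; rewrite row_mxKr.
(* [Ss s] is [S] with the infinitesimal [t] enlarged to a parameter [s] of [M], which is possible
   since the [U t] increase with [t]. *)
pose Ss s z := X (py z) /\ exists u, U s u /\ mul_graph G u (py z) (px z).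
have dSs s : definable M (Ss s).
  apply: definable_and; first exact: dpush.
  apply: definable_ex; apply: definable_and.
    by apply: dpush; [exact: definable_fiber|term_map_tac].
  by apply: definable_mul_graph; rewrite /px /py; term_map_tac.
have QSs s : 0 < s -> Q (Ss s).
  move=> s0; have dt : definable M (fun z => pt z ord0 ord0 <= s).
    by apply: dle; rewrite /pt; term_map_tac.
  apply: (du_sub uQ (definable_and dS dt) (dSs s) _ (du_and uQ dS dt QS (Qt _ s0))).
  move=> z [[Xy [u [Wu h]]] ts]; split=> //; exists u; split=> //.
  by apply: (U_mono _ _ ts); rewrite /U const_mx1.
have uq := du_pushforward ty uQ.
(* The type of the third coordinate [y] under [Q]. *)
pose q : ptype M n := fun phi => Q (fun z => defset phi (py z)).
have cq : complete_type q := ultrafilter_complete_type uq.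
have QX : Q (fun z => X (py z)).
  by apply: (du_sub uQ (dSs 1) _ _ (QSs _ ltr01)); [apply: dpush|move=> z []].
have qsub phi : X `<=` defset phi -> q phi.
  move=> Xphi; apply: (du_sub uQ _ _ _ QX); [exact: dpush| |by move=> z /Xphi].
  by apply: dpush => //; exists phi.
have qsets D : definable M D -> type_sets q D <-> Q (fun z => D (py z)).
  by move=> [phi <-]; apply: type_sets_defset.
have dU s : definable M (U s) by apply: definable_fiber.
exists q; split.
- by split=> //; exists gam => //; apply: qsub; rewrite hgam.
- exact: ultrafilter_definable_type uq.
- split; apply/(ptype_mul_entails PT dW U_nbhs U_basis U_mono) => //.
    move=> s D s0 dD DG /(qsets _ dD) qD; have UG := U_sub PT U_nbhs s0.
    have dUD := definable_prodset (dU s) dD UG DG.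
    (* [Qx] transfers from [p] to [Q], so the argument is by contradiction: if the complement of
       [U_s D] were in [p], then [Q] would place [x] outside [U_s D], while [x] is in [U_s y] with
       [y] in [D]. *)
    apply: contrapT => /(du_notN uP dUD)/(Qx _ (definable_not dUD)).
    apply: (du_consistent uQ); first exact: dpush.
    have dDy := dpush _ _ _ dD ty.
    apply: (du_sub uQ _ _ _ (du_and uQ (dSs s) dDy (QSs s s0) qD)).
    + exact: definable_and.
    + exact: dpush.
    move=> z [[_ [u [Uu [_ _ ->]]]] Dy]; exists u => //; by exists (py z).
  move=> s D s0 dD DG pD; have UG := U_sub PT U_nbhs s0.
  have dUD := definable_prodset (dU s) dD UG DG.
  (* Now [y] is recovered from [x]: from [x = u y] follows that [y] is the inverse of [u] times [x],
     so [r] is taken such that inverses of elements of [U r] lie in [U s]. *)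
  have [r r0 Ur] := U_inv PT U_nbhs U_basis s0.
  apply/(qsets _ dUD); have dDx := dpush _ _ _ dD tx.
  apply: (du_sub uQ _ _ _ (du_and uQ (dSs r) dDx (QSs r r0) (Qx _ dD pD))).
  + exact: definable_and.
  + exact: dpush.
  move=> z [[_ [u [Uu [Gu Gy E]]]] Dx]; exists (ginv G u); first exact: Ur.
  exists (px z) => //; rewrite E gmulA ?gmulVg ?gmul1g //; exact: ginv_closed.
- by apply: qsub => x [].
Qed.

End Replacement.

(** * Minimizing the dimension within the class *)

Theorem corollary3p5 (R : rcfType) (M : expansion R) (n : nat)
    (G : definable_group M n) (tau : set (set 'rV[R]_n)) (p : ptype M n) :
  o_minimal M ->
  Pillay_topology G tau ->
  S_G G p -> definable_type p ->
  exists q : ptype M n,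
    [/\ S_G G q, definable_type q, mu_reduced G tau q
      & mu_class G tau p = mu_class G tau q].
Proof.
move=> omin PT Sp dp.
(* All types of the class compete, definable or not, as in [mu_reduced]; [p] itself shows that some
   dimension occurs. *)
pose dims d := exists q, [/\ S_G G q, mu_class G tau q = mu_class G tau p & dim_type q = d].
have ex : exists d, `[< dims d >] by exists (dim_type p); apply/asboolP; exists p.
have [_ /asboolP[q0 [Sq0 Eq0 <-]] min] := ex_minnP ex.
have pq0 : mu_equiv G tau p q0.
  have : mu_class G tau q0 q0 by split=> //; apply: logically_equivalent_refl.
  by rewrite Eq0 => -[].
have [gam q0gam _] := Sq0.2.
have [psi q0psi dpsi] := dim_type_attained q0gam.
have [q [Sq dq pq qpsi]] := mu_equiv_definable_type omin PT Sp dp Sq0 pq0 q0psi.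
have Epq := mu_class_eq pq.
(* [q] contains [psi], so its dimension is at most that of [q0], the least one in the class. *)
exists q; split=> // r Sr Er; apply: leq_trans (dim_type_le qpsi) _; rewrite dpsi.
by apply: min; apply/asboolP; exists r; split=> //; rewrite Er Epq.
Qed.
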